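(* Let $(A,\blacktriangleright,\blacktriangleleft,\alpha)$ be a Hom-M-dendriform algebra. (i) The product $x\cdot y=x\blacktriangleleft y+x\blacktriangleright y$ defines a Hom-pre-Malcev algebra $(A,\cdot,\alpha)$ (the associated horizontal Hom-pre-Malcev algebra). (ii) The product $x\diamond y=x\blacktriangleleft y-y\blacktriangleright x$ defines a Hom-pre-Malcev algebra $(A,\diamond,\alpha)$ (the associated vertical Hom-pre-Malcev algebra). (iii) $(A,\cdot,\alpha)$ and $(A,\diamond,\alpha)$ have the same associated Hom-Malcev algebra $(A,[-,-],\alpha)$, with $[x,y]=x\cdot y-y\cdot x=x\diamond y-y\diamond x$.
   Context: All vector spaces are over a field $\mathbb K$ of characteristic $0$. A Hom-algebra is a vector space with a bilinear product (or several) and a linear twisting map $\alpha$; all are assumed multiplicative, i.e. $\alpha$ is an endomorphism of each product. A Hom-Malcev algebra is a Hom-algebra $(A,[-,-],\alpha)$ with $[-,-]$ anti-symmetric and $J_\alpha(\alpha(x),\alpha(y),[x,z])=[J_\alpha(x,y,z),\alpha^2(x)]$, where $J_\alpha(x,y,z)=[[x,y],\alpha(z)]+[[y,z],\alpha(x)]+[[z,x],\alpha(y)]$. A Hom-pre-Malcev algebra is a Hom-algebra $(A,\cdot,\alpha)$ such that, with $[x,y]=x\cdot y-y\cdot x$, for all $x,y,z,t\in A$: $$[\alpha(y),\alpha(z)]\cdot\alpha(x\cdot t)+[[x,y],\alpha(z)]\cdot\alpha^2(t)+\alpha^2(y)\cdot([x,z]\cdot\alpha(t))-\alpha^2(x)\cdot(\alpha(y)\cdot(z\cdot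 t))+\alpha^2(z)\cdot(\alpha(x)\cdot(y\cdot t))=0.$$ Its associated Hom-Malcev algebra is $A$ with the commutator bracket and $\alpha$. A Hom-M-dendriform algebra $(A,\blacktriangleright,\blacktriangleleft,\alpha)$ is a vector space $A$ with bilinear products $\blacktriangleright,\blacktriangleleft$ and a linear map $\alpha$ (multiplicative for both products) such that, with $x\cdot y=x\blacktriangleleft y+x\blacktriangleright y$, $x\diamond y=x\blacktriangleleft y-y\blacktriangleright x$, $[x,y]=x\cdot y-y\cdot x=x\diamond y-y\diamond x$, for all $x,y,z,t\in A$: (D1) $(\alpha(z)\diamond(y\diamond x))\blacktriangleright\alpha^2(t)-\alpha^2(x)\blacktriangleright(\alpha(y)\cdot(z\cdot t))+\alpha^2(z)\blacktriangleleft(\alpha(x)\blacktriangleright(y\cdot t))+\alpha([y,z])\blacktriangleleft\alpha(x\blacktriangleright t)-\alpha^2(y)\blacktriangleleft((z\diamond x)\blacktriangleright\alpha(t))=0$; (D2) $\alpha^2(z)\blacktriangleleft(\alpha(x)\blacktriangleleft(y\blacktriangleright t))-(\alpha(z)\diamond(x\diamond y))\blacktriangleright\alpha^2(t)-\alpha^2(x)\blacktriangleleft(\alpha(y)\blacktriangleright(z\cdot t))-\alpha(z\diamond y)\blacktriangleright\alpha(x\cdot t)+\alpha^2(y)\blacktriangleright([x,z]\cdot\alpha(t))=0$; (D3) $\alpha^2(z)\blacktriangleright(\alpha(x)\cdot(y\cdot t))+([x,y]\diamond\alpha(z))\blacktriangleright\alpha^2(t)-\alpha^2(x)\blacktriangleleft(\alpha(y)\blacktriangleleft(z\blacktriangleright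 t))+\alpha(y\diamond z)\blacktriangleright\alpha(x\cdot t)+\alpha^2(y)\blacktriangleleft((x\diamond z)\blacktriangleright\alpha(t))=0$; (D4) $[[x,y],\alpha(z)]\blacktriangleleft\alpha^2(t)-\alpha^2(x)\blacktriangleleft(\alpha(y)\blacktriangleleft(z\blacktriangleleft t))+\alpha^2(z)\blacktriangleleft(\alpha(x)\blacktriangleleft(y\blacktriangleleft t))+\alpha([y,z])\blacktriangleleft\alpha(x\blacktriangleleft t)+\alpha^2(y)\blacktriangleleft([x,z]\blacktriangleleft\alpha(t))=0$. *)

(* Defs.v *)
From mathcomp Require Import all_boot all_order all_algebra.

Set Implicit Arguments.
Unset Strict Implicit.
Unset Printing Implicit Defensive.

Import GRing.Theory.
Local Open Scope ring_scope.

Section HomAlgebras.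
Variables (K : fieldType) (A : lmodType K).
Implicit Types (mul tr tl : A -> A -> A) (alpha : A -> A).

(* All Hom-algebras are multiplicative: alpha is an endomorphism of mul. *)
Definition hom_algebra mul alpha : Prop :=
  [/\ bilinear_for *:%R *:%R mul,
      linear alpha &
      {morph alpha : x y / mul x y}].

Definition commutator mul (x y : A) : A := mul x y - mul y x.

Definition hom_jacobian (br : A -> A -> A) alpha (x y z : A) : A :=
  br (br x y) (alpha z) + br (br y z) (alpha x) + br (br z x) (alpha y).

Definition hom_malcev (br : A -> A -> A) alpha : Prop :=
  [/\ hom_algebra br alpha,
      forall x y, br x y = - br y x &
      forall x y z,
        hom_jacobian br alpha (alpha x) (alpha y) (br x z)
        = br (hom_jacobian br alpha x y z) (alpha (alpha x))].

Definition hom_pre_malcev mul alpha : Prop :=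
  let br := commutator mul in
  let alpha2 x := alpha (alpha x) in
  hom_algebra mul alpha /\
  forall x y z t,
    mul (br (alpha y) (alpha z)) (alpha (mul x t))
    + mul (br (br x y) (alpha z)) (alpha2 t)
    + mul (alpha2 y) (mul (br x z) (alpha t))
    - mul (alpha2 x) (mul (alpha y) (mul z t))
    + mul (alpha2 z) (mul (alpha x) (mul y t)) = 0.

(* tr is the product ▶ and tl is the product ◀. *)
Definition horizontal tr tl (x y : A) : A := tl x y + tr x y.

Definition vertical tr tl (x y : A) : A := tl x y - tr y x.

Section DendriformAxioms.
Variables (tr tl : A -> A -> A) (alpha : A -> A).

Local Notation "x ▶ y" := (tr x y) (at level 40).
Local Notation "x ◀ y" := (tl x y) (at level 40).
Local Notation "x ⋅ y" := (horizontal tr tl x y) (at level 40).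
Local Notation "x ⋄ y" := (vertical tr tl x y) (at level 40).
Local Notation br := (commutator (horizontal tr tl)).
Local Notation α := alpha.
Local Notation "α² x" := (alpha (alpha x)) (at level 10, x at level 9).

Definition dendriform_axiom1 : Prop := forall x y z t,
  (α z ⋄ (y ⋄ x)) ▶ α² t - α² x ▶ (α y ⋅ (z ⋅ t))
  + α² z ◀ (α x ▶ (y ⋅ t)) + α (br y z) ◀ α (x ▶ t)
  - α² y ◀ ((z ⋄ x) ▶ α t) = 0.

Definition dendriform_axiom2 : Prop := forall x y z t,
  α² z ◀ (α x ◀ (y ▶ t)) - (α z ⋄ (x ⋄ y)) ▶ α² t
  - α² x ◀ (α y ▶ (z ⋅ t)) - α (z ⋄ y) ▶ α (x ⋅ t)
  + α² y ▶ (br x z ⋅ α t) = 0.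

Definition dendriform_axiom3 : Prop := forall x y z t,
  α² z ▶ (α x ⋅ (y ⋅ t)) + (br x y ⋄ α z) ▶ α² t
  - α² x ◀ (α y ◀ (z ▶ t)) + α (y ⋄ z) ▶ α (x ⋅ t)
  + α² y ◀ ((x ⋄ z) ▶ α t) = 0.

Definition dendriform_axiom4 : Prop := forall x y z t,
  br (br x y) (α z) ◀ α² t - α² x ◀ (α y ◀ (z ◀ t))
  + α² z ◀ (α x ◀ (y ◀ t)) + α (br y z) ◀ α (x ◀ t)
  + α² y ◀ (br x z ◀ α t) = 0.

Definition hom_M_dendriform : Prop :=
  [/\ hom_algebra tr alpha, hom_algebra tl alpha &
      [/\ dendriform_axiom1, dendriform_axiom2,
          dendriform_axiom3 & dendriform_axiom4]].

End DendriformAxioms.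

End HomAlgebras.

(* Main.v *)
Require Import Defs.
From HB Require Import structures.
From mathcomp Require Import all_boot all_order all_algebra.
From mathcomp Require Import ring.

Set Implicit Arguments.
Unset Strict Implicit.
Unset Printing Implicit Defensive.

Import GRing.Theory.
Local Open Scope ring_scope.

(* Multiplicativity moves alpha down to the arguments, so that all identities
   become Z-linear relations between nonassociative monomials in x, y, z, t.
   Write D1..D4 for the left-hand sides of the dendriform axioms and P for that
   of the Hom-pre-Malcev identity of a product.  For the horizontal product
     P(x,y,z,t) = (D1 + D2 + D3 + D4)(x,y,z,t);
   for the vertical product, where t is no longer the rightmost argument of
   every monomial,
     P(x,y,z,t) = D4(x,y,z,t) + D1(t,z,y,x) - D1(t,x,z,y) - D1(t,z,x,y)
                  - D2(x,t,z,y) + D2(y,t,x,z) - D2(z,t,x,y) - D3(x,z,t,y);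
   and for every Hom-pre-Malcev product the Hom-Malcev identity of its
   commutator at x, y, z is
     P(x,x,y,z) - P(x,y,z,x) + P(x,z,x,y) - P(x,z,y,x) - P(y,z,x,x)
     - P(z,x,y,x) = 0. *)

Section SquareZeroExtension.
Variable V : zmodType.

(** The trivial extension of the integers by [V], which becomes an ideal of square zero. Integer
    scalars suffice, since all the relations have integer coefficients. *)
Definition square_zero := (int * V)%type.
HB.instance Definition _ := GRing.Zmodule.on square_zero.

Implicit Types x y z : square_zero.

Definition square_zero_mul x y : square_zero :=
  (x.1 * y.1, y.2 *~ x.1 + x.2 *~ y.1).

Lemma square_zero_mulA : associative square_zero_mul.
Proof.
move=> [a u] [b v] [c w]; congr pair; rewrite /= ?mulrA //.
by rewrite !mulrzDl -!mulrzA addrA [b * a]mulrC [c * a]mulrC.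
Qed.

Lemma square_zero_mulC : commutative square_zero_mul.
Proof. by move=> x y; congr pair; [exact: mulrC | exact: addrC]. Qed.

Lemma square_zero_mul1 : left_id (1, 0) square_zero_mul.
Proof. by move=> [a u]; congr pair; rewrite /= ?mul1r ?mulr1z ?mul0rz ?addr0. Qed.

Lemma square_zero_mulDl : left_distributive square_zero_mul +%R.
Proof.
move=> [a u] [b v] [c w]; congr pair; rewrite /= ?mulrDl //.
by rewrite mulrzDr mulrzDl addrACA.
Qed.

Lemma square_zero_oner_neq0 : ((1, 0) : square_zero) != 0.
Proof. by apply/eqP => -[]. Qed.

HB.instance Definition _ := GRing.Zmodule_isComNzRing.Build square_zero
  square_zero_mulA square_zero_mulC square_zero_mul1 square_zero_mulDl
  square_zero_oner_neq0.

Definition to_square_zero (u : V) : square_zero := (0, u).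

Lemma to_square_zero_is_zmod_morphism : zmod_morphism to_square_zero.
Proof. by move=> u v; congr pair; rewrite /= subr0. Qed.

HB.instance Definition _ := GRing.isZmodMorphism.Build V square_zero
  to_square_zero to_square_zero_is_zmod_morphism.

Lemma to_square_zero_inj : injective to_square_zero.
Proof. by move=> u v []. Qed.

End SquareZeroExtension.

(* [ring] only works in commutative rings, but it sees through additive maps
   into one; embedding the module in its square-zero extension thus lets it
   decide identities of abelian groups. *)
Ltac abelian := apply: to_square_zero_inj; ring.

Section ZmoduleLemmas.
Variables V W : zmodType.

(** The products and [alpha] are bare functions, so compatibility with opposites has to come from
    additivity. *)
Lemma additive_morphN (f : V -> W) :
  {morph f : x y / x + y} -> {morph f : x / - x}.
Proof.
move=> fD x; have f0 : f 0 = 0 by apply: (addrI (f 0)); rewrite -fD !addr0.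
by apply: (addrI (f x)); rewrite -fD !subrr.
Qed.

Lemma addr_eq_zero (a b : V) : a = 0 -> b = 0 -> a + b = 0.
Proof. by move=> -> ->; rewrite addr0. Qed.

Lemma subr_eq_zero (a b : V) : a = 0 -> b = 0 -> a - b = 0.
Proof. by move=> -> ->; rewrite subr0. Qed.

(** Here [e] is a combination of axiom instances; after expansion into monomials, [l - r = e] is an
    identity of abelian groups. *)
Lemma eq_from_relation (e l r : V) : e = 0 -> l - r = e -> l = r.
Proof. by move=> -> /subr0_eq. Qed.

End ZmoduleLemmas.

Section HomAlgebraTheory.
Variables (K : fieldType) (A : lmodType K).
Implicit Types (mul tr tl : A -> A -> A) (alpha : A -> A).

Section Expansion.
Variables (mul : A -> A -> A) (alpha : A -> A).
Hypothesis homA : hom_algebra mul alpha.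

Lemma hom_mulDl z : {morph mul^~ z : x y / x + y}.
Proof. by move=> x y; case: homA => -[+ _] _ _ => /(_ z 1 x y) /=; rewrite !scale1r. Qed.

Lemma hom_mulDr z : {morph mul z : x y / x + y}.
Proof. by move=> x y; case: homA => -[_ +] _ _ => /(_ z 1 x y) /=; rewrite !scale1r. Qed.

Lemma hom_mulNl z : {morph mul^~ z : x / - x}.
Proof. exact: additive_morphN (hom_mulDl z). Qed.

Lemma hom_mulNr z : {morph mul z : x / - x}.
Proof. exact: additive_morphN (hom_mulDr z). Qed.

Lemma hom_alphaD : {morph alpha : x y / x + y}.
Proof. by move=> x y; case: homA => _ + _ => /(_ 1 x y); rewrite !scale1r. Qed.

Lemma hom_alphaN : {morph alpha : x / - x}.
Proof. exact: additive_morphN hom_alphaD. Qed.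

Lemma hom_alphaM : {morph alpha : x y / mul x y}.
Proof. by case: homA. Qed.

Definition hom_expand := (hom_alphaD, hom_alphaN, hom_alphaM,
  (hom_mulDl, hom_mulDr, hom_mulNl, hom_mulNr)).

End Expansion.

(** Makes [commutator] and [vertical] differences of two Hom-algebra products. *)
Lemma hom_algebra_flip mul alpha :
  hom_algebra mul alpha -> hom_algebra (fun x y => mul y x) alpha.
Proof. by case=> -[mull mulr] lin mulM; split. Qed.

Lemma hom_algebraD mul1 mul2 alpha :
  hom_algebra mul1 alpha -> hom_algebra mul2 alpha ->
  hom_algebra (fun x y => mul1 x y + mul2 x y) alpha.
Proof.
move=> hom1 hom2; have [[mull1 mulr1] lin mulM1] := hom1.
have [[mull2 mulr2] _ mulM2] := hom2; split=> //; last first.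
  by move=> x y; rewrite (hom_alphaD hom1) mulM1 mulM2.
by split=> z a x y; rewrite ?(mull1, mull2, mulr1, mulr2) /= scalerDr addrACA.
Qed.

Lemma hom_algebraB mul1 mul2 alpha :
  hom_algebra mul1 alpha -> hom_algebra mul2 alpha ->
  hom_algebra (fun x y => mul1 x y - mul2 x y) alpha.
Proof.
move=> hom1 hom2; apply: hom_algebraD => //.
have [[mull mulr] lin mulM] := hom2; split=> //; last first.
  by move=> x y; rewrite (hom_alphaN hom2) mulM.
by split=> z a x y; rewrite ?(mull, mulr) /= opprD scalerN.
Qed.

Lemma hom_algebra_commutator mul alpha :
  hom_algebra mul alpha -> hom_algebra (commutator mul) alpha.
Proof. by move=> homA; apply/hom_algebraB/hom_algebra_flip. Qed.

Lemma hom_algebra_horizontal tr tl alpha :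
  hom_algebra tr alpha -> hom_algebra tl alpha ->
  hom_algebra (horizontal tr tl) alpha.
Proof. by move=> homr homl; apply: hom_algebraD. Qed.

Lemma hom_algebra_vertical tr tl alpha :
  hom_algebra tr alpha -> hom_algebra tl alpha ->
  hom_algebra (vertical tr tl) alpha.
Proof. by move=> homr homl; apply/hom_algebraB/hom_algebra_flip. Qed.

Lemma hom_malcev_commutator mul alpha :
  hom_pre_malcev mul alpha -> hom_malcev (commutator mul) alpha.
Proof.
move=> [homA pm]; split; first exact: hom_algebra_commutator.
  by move=> x y; rewrite opprB.
move=> x y z.
(* The Malcev identity is quadratic in x while P is multilinear, so each instance of P takes x
   twice. *)
have rel := subr_eq_zero (subr_eq_zero (subr_eq_zero (addr_eq_zero
  (subr_eq_zero (pm x x y z) (pm x y z x)) (pm x z x y)) (pm x z y x))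
  (pm y z x x)) (pm z x y x).
apply: (eq_from_relation rel).
by rewrite /hom_jacobian /commutator !(hom_expand homA); abelian.
Qed.

Lemma commutator_vertical tr tl :
  commutator (horizontal tr tl) =2 commutator (vertical tr tl).
Proof. by move=> x y; rewrite /commutator /horizontal /vertical; abelian. Qed.

Lemma hom_pre_malcev_horizontal tr tl alpha :
  hom_M_dendriform tr tl alpha -> hom_pre_malcev (horizontal tr tl) alpha.
Proof.
move=> [homr homl [d1 d2 d3 d4]]; split; first exact: hom_algebra_horizontal.
move=> x y z t.
have rel := addr_eq_zero (addr_eq_zero (addr_eq_zero
  (d1 x y z t) (d2 x y z t)) (d3 x y z t)) (d4 x y z t).
apply: (eq_from_relation rel).
rewrite /commutator /horizontal /vertical.
by rewrite !(hom_expand homr, hom_expand homl); abelian.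
Qed.

Lemma hom_pre_malcev_vertical tr tl alpha :
  hom_M_dendriform tr tl alpha -> hom_pre_malcev (vertical tr tl) alpha.
Proof.
move=> [homr homl [d1 d2 d3 d4]]; split; first exact: hom_algebra_vertical.
move=> x y z t.
(* Every monomial of an axiom ends in its fourth argument, so P splits by rightmost factor: D4 gives
   the part ending in t, D1(t,z,y,x) that in x, D2(y,t,x,z) that in z, and the other five instances
   that in y. *)
have rel := subr_eq_zero (subr_eq_zero (addr_eq_zero (subr_eq_zero
  (subr_eq_zero (subr_eq_zero (addr_eq_zero
  (d4 x y z t) (d1 t z y x)) (d1 t x z y)) (d1 t z x y))
  (d2 x t z y)) (d2 y t x z)) (d2 z t x y)) (d3 x z t y).
apply: (eq_from_relation rel).
rewrite /commutator /horizontal /vertical.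
by rewrite !(hom_expand homr, hom_expand homl); abelian.
Qed.

End HomAlgebraTheory.

Theorem theorem4p1 (K : fieldType) (charK0 : [pchar K] =i pred0)
    (A : lmodType K) (tr tl : A -> A -> A) (alpha : A -> A)
    (dendA : hom_M_dendriform tr tl alpha) :
  [/\ hom_pre_malcev (horizontal tr tl) alpha,
      hom_pre_malcev (vertical tr tl) alpha &
      [/\ commutator (horizontal tr tl) =2 commutator (vertical tr tl),
          hom_malcev (commutator (horizontal tr tl)) alpha &
          hom_malcev (commutator (vertical tr tl)) alpha]].
Proof.
have horA := hom_pre_malcev_horizontal dendA.
have verA := hom_pre_malcev_vertical dendA.
split=> //; split; last 2 first; [exact: hom_malcev_commutator..|].
exact: commutator_vertical.
Qed.
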